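(* Let $R$ be a Cohen-Macaulay fiber product ring. Let $M$ and $N$ be nonzero finitely generated $R$-modules. If $N$ is Tor-rigid and $\operatorname{Ext}^i_R(M,N)=0$ for some $i>1$, then $\operatorname{pd}_R M\le 1$ or $\operatorname{pd}_R N\le 1$.
   Context: All local rings are commutative and Noetherian, and all modules are finitely generated; $\operatorname{pd}$ denotes projective dimension. A local ring $(R,\mathfrak m,k)$ is a fiber product ring if $R\cong S\times_k T=\{(s,t)\in S\times T : \pi_S(s)=\pi_T(t)\}$, where $S,T$ are local rings with the same residue field $k$, neither of them equal to $k$, and $\pi_S,\pi_T$ are the reductions modulo the maximal ideals. Equivalently, $\mathfrak m=I\oplus J$ for nonzero ideals $I,J$ of $R$. An $R$-module $N$ is Tor-rigid if for every $R$-module $Z$ and every $n\ge 1$, $\operatorname{Tor}^R_n(N,Z)=0$ implies $\operatorname{Tor}^R_{n+1}(N,Z)=0$. *)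

(* Defs.v *)
From HB Require Import structures.
From mathcomp Require Import all_boot all_order all_algebra.
From mathcomp Require Import boolp classical_sets.
Set Implicit Arguments.
Unset Strict Implicit.
Unset Printing Implicit Defensive.
Import GRing.Theory.
Local Open Scope classical_set_scope.
Local Open Scope quotient_scope.
Local Open Scope ring_scope.

Section Ideals.
Variable R : comNzRingType.
Implicit Types (I J : set R) (s : seq R).

Definition is_ideal I : Prop :=
  [/\ I 0, forall x y, I x -> I y -> I (x + y) & forall a x, I x -> I (a * x)].

Definition ideal_gen s : set R :=
  [set x | exists c : 'I_(size s) -> R, x = \sum_j c j * s`_j].

Definition prime_ideal I : Prop :=
  [/\ is_ideal I, ~ I 1 & forall x y, I (x * y) -> I x \/ I y].

Definition maximal_ideal I : Prop :=
  [/\ is_ideal I, ~ I 1 &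
      forall J, is_ideal J -> ~ J 1 -> I `<=` J -> J = I].

Definition noetherian : Prop :=
  forall I, is_ideal I -> exists s, I = ideal_gen s.

Definition local_ring : Prop := noetherian /\ exists! m, maximal_ideal m.

(* [s] is a regular sequence on the ring: its [j]-th term is a nonzerodivisor
   modulo the previous ones, and [R / (s)] is nonzero. *)
Definition regular_sequence s : Prop :=
  (forall j a, (j < size s)%N ->
     ideal_gen (take j s) (s`_j * a) -> ideal_gen (take j s) a) /\
  ~ ideal_gen s 1.

Definition is_max (P : nat -> Prop) (d : nat) : Prop :=
  P d /\ forall n, P n -> (n <= d)%N.

Definition is_depth (m : set R) (d : nat) : Prop :=
  is_max (fun n => exists s,
    [/\ size s = n, forall x, x \in s -> m x & regular_sequence s]) d.

Definition is_krull_dim (d : nat) : Prop :=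
  is_max (fun n => exists p : nat -> set R,
    (forall j, (j <= n)%N -> prime_ideal (p j)) /\
    (forall j, (j < n)%N -> p j `<` p j.+1)) d.

(* Meant for local rings, where [m] is unique and both numbers are finite. *)
Definition cohen_macaulay : Prop :=
  exists m : set R, maximal_ideal m /\
    exists d : nat, is_depth m d /\ is_krull_dim d.

End Ideals.

(* The kernel of a surjection [pS] from a local ring [S] onto a field is the
   maximal ideal, so [pS] is reduction modulo the maximal ideal, and [S] differs
   from the residue field exactly when [pS] has a nonzero kernel. The image of
   the injective morphism [f] is the fiber product of [pS] and [pT]. *)
Definition fiber_product_ring (R : comNzRingType) : Prop :=
  exists (S T : comNzRingType) (k : fieldType)
         (pS : {rmorphism S -> k}) (pT : {rmorphism T -> k})
         (f : {rmorphism R -> S * T}),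
    [/\ local_ring S /\ local_ring T,
        (forall c, exists s, pS s = c) /\ (forall c, exists t, pT t = c),
        (exists2 s, s != 0 & pS s = 0) /\ (exists2 t, t != 0 & pT t = 0),
        injective f &
        forall u : S * T, (exists r, f r = u) <-> pS u.1 = pT u.2].

Section Modules.
Variable R : comNzRingType.
Implicit Types M N : lmodType R.

Definition fin_gen M : Prop :=
  exists n (g : 'I_n -> M), forall x, exists c : 'I_n -> R,
    x = \sum_i c i *: g i.

Definition nonzero_module M : Prop := exists x : M, x != 0.

End Modules.

(* The tensor product of [M] and [N]: formal sums of pairs (sequences), two of
   them being identified when every bilinear map gives them the same value. The
   lemmas [tensor_lift_pure] and [tensor_ext] are its universal property. *)
Section Tensor.
Variables (R : comNzRingType) (M N : lmodType R).
Implicit Types s t u : seq (M * N).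

Definition eval_sum (L : lmodType R) (b : M -> N -> L) s : L :=
  \sum_(p <- s) b p.1 p.2.

Definition tensor_rel s t : bool :=
  `[< forall (L : lmodType R) (b : {bilinear M -> N -> L}),
        eval_sum b s = eval_sum b t >].

Fact tensor_relP s t :
  reflect (forall (L : lmodType R) (b : {bilinear M -> N -> L}),
             eval_sum b s = eval_sum b t) (tensor_rel s t).
Proof. exact: asboolP. Qed.

Fact tensor_equiv_class : equiv_class_of tensor_rel.
Proof.
split=> [s|s t|t s u].
- by apply/tensor_relP.
- by apply/tensor_relP/tensor_relP => h L b; rewrite h.
- by move=> /tensor_relP h /tensor_relP h'; apply/tensor_relP => L b; rewrite h.
Qed.

Canonical tensor_equiv := EquivRelPack tensor_equiv_class.

Definition tensor := {eq_quot tensor_equiv}.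

HB.instance Definition _ := Choice.on tensor.
HB.instance Definition _ := EqQuotient.on tensor.

Fact tensor_piP s t :
  (forall (L : lmodType R) (b : {bilinear M -> N -> L}),
     eval_sum b s = eval_sum b t) <-> \pi_tensor s = \pi_tensor t.
Proof.
split=> [h|/eqmodP/tensor_relP//].
by apply/eqmodP/tensor_relP.
Qed.

Definition seq_scale (a : R) s : seq (M * N) := [seq (a *: p.1, p.2) | p <- s].

Fact eval_sum_cat (L : lmodType R) (b : M -> N -> L) s t :
  eval_sum b (s ++ t) = eval_sum b s + eval_sum b t.
Proof. exact: big_cat. Qed.

Fact eval_sum_scale (L : lmodType R) (b : {bilinear M -> N -> L}) a s :
  eval_sum b (seq_scale a s) = a *: eval_sum b s.
Proof.
rewrite /eval_sum big_map scaler_sumr; apply: eq_bigr => p _.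
by rewrite linearZl_LR.
Qed.

Definition tensor_add (x y : tensor) : tensor :=
  \pi_tensor (repr x ++ repr y).
Definition tensor_scale (a : R) (x : tensor) : tensor :=
  \pi_tensor (seq_scale a (repr x)).
Definition tensor_zero : tensor := \pi_tensor [::].
Definition tensor_opp (x : tensor) : tensor := tensor_scale (-1) x.

Fact eval_repr (L : lmodType R) (b : {bilinear M -> N -> L}) s :
  eval_sum b (repr (\pi_tensor s)) = eval_sum b s.
Proof. by apply/tensor_piP: L b; rewrite reprK. Qed.

Definition eval_simp := (eval_repr, eval_sum_cat, eval_sum_scale).

Fact tensor_eqP (x y : tensor) :
  (forall (L : lmodType R) (b : {bilinear M -> N -> L}),
     eval_sum b (repr x) = eval_sum b (repr y)) -> x = y.
Proof. by move/tensor_piP; rewrite !reprK. Qed.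

Fact tensor_addA : associative tensor_add.
Proof. by move=> x y z; apply: tensor_eqP => L b; rewrite !eval_simp addrA. Qed.
Fact tensor_addC : commutative tensor_add.
Proof. by move=> x y; apply: tensor_eqP => L b; rewrite !eval_simp addrC. Qed.
Fact tensor_add0 : left_id tensor_zero tensor_add.
Proof.
move=> x; apply: tensor_eqP => L b.
by rewrite !eval_simp /eval_sum big_nil add0r.
Qed.
Fact tensor_addN : left_inverse tensor_zero tensor_opp tensor_add.
Proof.
move=> x; apply: tensor_eqP => L b.
by rewrite !eval_simp scaleN1r addNr /eval_sum big_nil.
Qed.

HB.instance Definition _ := GRing.isZmodule.Build tensor
  tensor_addA tensor_addC tensor_add0 tensor_addN.

Fact tensor_scaleA a b x :
  tensor_scale a (tensor_scale b x) = tensor_scale (a * b) x.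
Proof. by apply: tensor_eqP => L c; rewrite !eval_simp scalerA. Qed.
Fact tensor_scale1 : left_id 1 tensor_scale.
Proof. by move=> x; apply: tensor_eqP => L c; rewrite !eval_simp scale1r. Qed.
Fact tensor_scaleDr : right_distributive tensor_scale +%R.
Proof.
by move=> a x y; apply: tensor_eqP => L c; rewrite !eval_simp scalerDr.
Qed.
Fact tensor_scaleDl x : {morph tensor_scale^~ x : a b / a + b}.
Proof.
by move=> a b; apply: tensor_eqP => L c; rewrite !eval_simp scalerDl.
Qed.

HB.instance Definition _ := GRing.Zmodule_isLmodule.Build R tensor
  tensor_scaleA tensor_scale1 tensor_scaleDr tensor_scaleDl.

Definition tensor_pure (x : M) (y : N) : tensor := \pi_tensor [:: (x, y)].

Fact eval_sum1 (L : lmodType R) (b : M -> N -> L) x y :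
  eval_sum b [:: (x, y)] = b x y.
Proof. by rewrite /eval_sum big_seq1. Qed.

Fact tensor_pure_bilinear : bilinear_for *:%R *:%R tensor_pure.
Proof.
split=> [y a x x'|x a y y']; apply: tensor_eqP => L b.
- by rewrite !eval_simp !eval_sum1 linearPl.
- by rewrite !eval_simp !eval_sum1 linearPr.
Qed.

HB.instance Definition _ :=
  bilinear_isBilinear.Build R M N tensor *:%R *:%R tensor_pure
    tensor_pure_bilinear.

Section Lift.
Variables (L : lmodType R) (b : {bilinear M -> N -> L}).

Definition tensor_lift (x : tensor) : L := eval_sum b (repr x).

Fact tensor_lift_linear : linear tensor_lift.
Proof. by move=> a x y; rewrite /tensor_lift !eval_simp. Qed.

HB.instance Definition _ :=
  GRing.isLinear.Build R tensor L *:%R tensor_lift tensor_lift_linear.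

Lemma tensor_lift_pure x y : tensor_lift (tensor_pure x y) = b x y.
Proof. by rewrite /tensor_lift eval_repr eval_sum1. Qed.

End Lift.

Lemma tensor_pure_gen (x : tensor) :
  x = \sum_(p <- repr x) tensor_pure p.1 p.2.
Proof.
rewrite -[LHS]reprK; elim: (repr x) => [|[y z] s IHs]; first by rewrite big_nil.
rewrite big_cons -IHs; apply: tensor_eqP => L b.
by rewrite !eval_simp /eval_sum big_cons big_seq1.
Qed.

Lemma tensor_ext (L : lmodType R) (f g : {linear tensor -> L}) :
  (forall x y, f (tensor_pure x y) = g (tensor_pure x y)) -> f =1 g.
Proof.
move=> fg x; rewrite [x]tensor_pure_gen !linear_sum.
by apply: eq_bigr => p _; apply: fg.
Qed.

End Tensor.

Section TensorMap.
Variables (R : comNzRingType) (M M' N : lmodType R) (f : {linear M -> M'}).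

Definition tensor_map_pure (x : M) (y : N) : tensor M' N := tensor_pure (f x) y.

Fact tensor_map_pure_bilinear : bilinear_for *:%R *:%R tensor_map_pure.
Proof.
split=> [y a x x'|x a y y']; rewrite /tensor_map_pure.
- by rewrite linearP linearPl.
- by rewrite linearPr.
Qed.

HB.instance Definition _ :=
  bilinear_isBilinear.Build R M N (tensor M' N) *:%R *:%R tensor_map_pure
    tensor_map_pure_bilinear.

Definition tensor_map : {linear tensor M N -> tensor M' N} :=
  tensor_lift tensor_map_pure.

Lemma tensor_mapE x y : tensor_map (tensor_pure x y) = tensor_pure (f x) y.
Proof. exact: tensor_lift_pure. Qed.

End TensorMap.
Arguments tensor_map {R M M'} N f.

Section Homological.
Variable R : comNzRingType.

Definition surjective_map (A B : Type) (f : A -> B) : Prop :=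
  forall y, exists x, f x = y.

Definition exact (A B C : lmodType R) (f : A -> B) (g : B -> C) : Prop :=
  forall y, g y = 0 <-> exists x, f x = y.

Definition projective (P : lmodType R) : Prop :=
  forall (A B : lmodType R) (g : {linear A -> B}) (f : {linear P -> B}),
    surjective_map g -> exists h : {linear P -> A}, forall x, g (h x) = f x.

Record proj_resolution (M : lmodType R) := ProjResolution {
  res_obj :> nat -> lmodType R;
  res_d : forall n, {linear res_obj n.+1 -> res_obj n};
  res_aug : {linear res_obj 0 -> M};
  res_projective : forall n, projective (res_obj n);
  res_aug_surj : surjective_map res_aug;
  res_aug_exact : exact (res_d 0) res_aug;
  res_d_exact : forall n, exact (res_d n.+1) (res_d n)
}.

Definition pd_le (M : lmodType R) (n : nat) : Prop :=
  exists P : proj_resolution M, forall j, (n < j)%N -> forall x : P j, x = 0.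

(* [Tor_n(N, Z) = 0], that is, the complex [P (x) Z] is exact in degree [n] for
   a projective resolution [P] of [N]; the choice of [P] does not matter. *)
Definition Tor_eq0 (n : nat) (N Z : lmodType R) : Prop :=
  exists P : proj_resolution N,
    match n with
    | 0 => surjective_map (tensor_map Z (res_d P 0))
    | n'.+1 => exact (tensor_map Z (res_d P n'.+1)) (tensor_map Z (res_d P n'))
    end.

(* [Ext^n(M, N) = 0], that is, the complex [Hom(P, N)] is exact in degree [n]
   (every cocycle is a coboundary) for a projective resolution [P] of [M]. *)
Definition Ext_eq0 (n : nat) (M N : lmodType R) : Prop :=
  exists P : proj_resolution M,
    forall f : {linear P n -> N}, (forall x, f (res_d P n x) = 0) ->
      match n return {linear P n -> N} -> Prop with
      | 0 => fun f => forall x, f x = 0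
      | n'.+1 => fun f =>
          exists g : {linear P n' -> N}, forall x, f x = g (res_d P n' x)
      end f.

Definition tor_rigid (N : lmodType R) : Prop :=
  forall Z : lmodType R, fin_gen Z -> forall n, (1 <= n)%N ->
    Tor_eq0 n N Z -> Tor_eq0 n.+1 N Z.

End Homological.

(* Main.v *)
Require Import Defs.
From HB Require Import structures.
From mathcomp Require Import all_boot all_order all_algebra.
From mathcomp Require Import boolp classical_sets.

(** The maximal ideal of a fiber product ring is a direct sum [I] + [J] of
    nonzero ideals ([fiber_product_split]). Since the intersection of [I] and
    [J] is zero, a vector with entries in the maximal ideal that is killed by a
    matrix splits into two killed vectors, one with entries in [I] and one with
    entries in [J]: second syzygies are direct sums ([kernel_split]). This has
    two consequences.

    - If Tor_i(X, N) = 0 for all i > 0, then the second syzygy of [X] or that of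
      [N] is zero ([tor_trivial_syzygy]). If, say, the [I]-part of the second
      syzygy of [N] is nonzero, then the third syzygy of [N] contains all the
      [J]-multiples of a vector [u] with a coordinate equal to 1
      ([unit_vector_right]). Multiplying [u] by the vectors of the second syzygy
      of [X] with entries in [J], the vanishing of Tor and Nakayama's lemma show
      that these are all zero. If that syzygy is not zero, the third syzygy of
      [X] therefore contains the [J]-multiples of a basis vector, and the same
      argument with [X] and [N] exchanged shows that the third syzygy of [N] has
      no nonzero vector with entries in [J], contrary to the choice of [u].
    - A nonzero second syzygy is not free ([second_syzygy_not_free]), so a
      module with a syzygy equal to zero has projective dimension at most 1.

    Now let (A_n) and (D_n) be the matrices of minimal free resolutions of [M]
    and [N], let Ext^i(M, N) = 0 with i > 1, and let [X] be the cokernel of the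
    transpose of A_i. Vanishing of Ext^i says that A_i B = V D_0 implies
    B = A_(i-1) C + W D_0, and this yields Tor_1(N, X) = 0, hence by rigidity
    Tor_n(N, X) = 0 for all n > 0. It also shows that the transpose of A_i is a
    minimal matrix, so that its kernel is the second syzygy of [X]. If this
    kernel is zero then so is A_(i-1), since A_i A_(i-1) = 0; the resolution of
    [M] then stops, and [M] has projective dimension at most 1. Otherwise the
    second syzygy of [N] is zero.

    Since Ext and Tor are defined by means of some projective resolution, the
    argument also uses that their vanishing does not depend on the resolution
    ([Ext_eq0_any], [Tor_eq0_any]); it can then be read on matrices
    ([Ext_eq0_mx], [tor_trivial_of_Tor], [Tor_eq0_of_mx]). *)

Set Implicit Arguments.
Unset Strict Implicit.
Unset Printing Implicit Defensive.
Import GRing.Theory.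
Local Open Scope classical_set_scope.
Local Open Scope quotient_scope.
Local Open Scope ring_scope.

(** * Ideals and the decomposition of the maximal ideal *)

Section IdealEntries.
Variable R : comNzRingType.
Implicit Types I J : set R.

Lemma ideal_sum I (X : finType) (F : X -> R) :
  is_ideal I -> (forall i, I (F i)) -> I (\sum_i F i).
Proof. by case=> I0 ID _ IF; apply: (big_ind I). Qed.

Lemma ideal_mulr I a x : is_ideal I -> I x -> I (x * a).
Proof. by case=> _ _ IM Ix; rewrite mulrC; apply: IM. Qed.

Lemma idealN I x : is_ideal I -> I x -> I (- x).
Proof. by case=> _ _ IM Ix; rewrite -mulN1r; apply: IM. Qed.

(** All entries of a matrix lie in [I]. *)
Definition entries_in I m n (A : 'M[R]_(m, n)) : Prop := forall i j, I (A i j).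

Lemma entries_inD I m n (A B : 'M[R]_(m, n)) :
  is_ideal I -> entries_in I A -> entries_in I B -> entries_in I (A + B).
Proof. by case=> _ ID _ IA IB i j; rewrite mxE; apply: ID. Qed.

Lemma entries_inN I m n (A : 'M[R]_(m, n)) :
  is_ideal I -> entries_in I A -> entries_in I (- A).
Proof. by move=> iI IA i j; rewrite mxE; apply: idealN. Qed.

Lemma entries_in_mull I m n p (A : 'M[R]_(m, n)) (B : 'M[R]_(n, p)) :
  is_ideal I -> entries_in I B -> entries_in I (A *m B).
Proof.
move=> iI IB i j; rewrite mxE; apply: ideal_sum => // k.
by case: iI => _ _; apply.
Qed.

Lemma entries_in_mulr I m n p (A : 'M[R]_(m, n)) (B : 'M[R]_(n, p)) :
  is_ideal I -> entries_in I A -> entries_in I (A *m B).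
Proof.
by move=> iI IA i j; rewrite mxE; apply: ideal_sum => // k; apply: ideal_mulr.
Qed.

(** The sum of two ideals. *)
Definition ideal_add I J : set R :=
  [set r | exists x y, [/\ I x, J y & r = x + y]].

Lemma ideal_add_ideal I J :
  is_ideal I -> is_ideal J -> is_ideal (ideal_add I J).
Proof.
move=> [I0 ID IM] [J0 JD JM]; split.
- by exists 0, 0; rewrite addr0.
- move=> _ _ [x [y [Ix Jy ->]]] [x' [y' [Ix' Jy' ->]]].
  exists (x + x'), (y + y').
  by split; [apply: ID | apply: JD | rewrite addrACA].
- move=> a _ [x [y [Ix Jy ->]]].
  by exists (a * x), (a * y); split; [apply: IM | apply: JM | rewrite mulrDr].
Qed.

Lemma ideal_addC I J : ideal_add I J = ideal_add J I.
Proof.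
by apply/seteqP; split=> _ [x [y [Ix Jy ->]]]; exists y, x; rewrite addrC.
Qed.

(** The ring is local, and its maximal ideal is the direct sum of the two
    nonzero ideals [I] and [J]. *)
Record split_local I J : Prop := SplitLocal {
  splitl_ideal : is_ideal I;
  splitr_ideal : is_ideal J;
  split_cap : forall x, I x -> J x -> x = 0;
  splitl_neq0 : exists2 x, I x & x != 0;
  splitr_neq0 : exists2 x, J x & x != 0;
  split_proper : ~ ideal_add I J 1;
  split_inv : forall r, ideal_add I J r \/ exists r', r * r' = 1 }.

Lemma split_localC I J : split_local I J -> split_local J I.
Proof.
case=> iI iJ c nI nJ p u; split=> //; rewrite 1?ideal_addC //.
by move=> x Jx Ix; apply: c.
Qed.

Lemma split_max_ideal I J : split_local I J -> is_ideal (ideal_add I J).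
Proof. by case=> iI iJ *; apply: ideal_add_ideal. Qed.

Lemma split_mul0 I J x y : split_local I J -> I x -> J y -> x * y = 0.
Proof.
move=> [iI iJ c _ _ _ _] Ix Jy; apply: c; first exact: ideal_mulr.
by case: iJ => _ _; apply.
Qed.

Lemma split_mulmx0 I J m n p (A : 'M[R]_(m, n)) (B : 'M[R]_(n, p)) :
  split_local I J -> entries_in I A -> entries_in J B -> A *m B = 0.
Proof.
move=> s IA JB; apply/matrixP=> i j; rewrite !mxE big1 // => k _.
exact: split_mul0 s _ _.
Qed.

Lemma split_capmx I J m n (A : 'M[R]_(m, n)) :
  split_local I J -> entries_in I A -> entries_in J A -> A = 0.
Proof.
move=> s IA JA; apply/matrixP=> i j; rewrite [RHS]mxE.
exact: (split_cap s).
Qed.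

Lemma entries_in_split I J m n (A : 'M[R]_(m, n)) :
  entries_in (ideal_add I J) A ->
  exists A1 A2, [/\ entries_in I A1, entries_in J A2 & A = A1 + A2].
Proof.
move=> mA.
have /choice[f fP] : forall u : 'I_m * 'I_n,
    exists xy : R * R, [/\ I xy.1, J xy.2 & A u.1 u.2 = xy.1 + xy.2].
  by case=> i j; have [x [y ?]] := mA i j; exists (x, y).
exists (\matrix_(i, j) (f (i, j)).1), (\matrix_(i, j) (f (i, j)).2).
split=> [i j|i j|]; rewrite ?mxE; try by have [] := fP (i, j).
by apply/matrixP=> i j; rewrite !mxE; have [] := fP (i, j).
Qed.

End IdealEntries.

(** * Local and fiber product rings *)

Section FiberProduct.
Variable R : comNzRingType.

Lemma local_ring_inv (m : set R) (r : R) :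
  local_ring R -> maximal_ideal m -> m r \/ exists r', r * r' = 1.
Proof.
move=> [_ [m0 [_ uniq_m]]] maxm.
have [[r' rr']|nr] := pselect (exists r', r * r' = 1).
  by right; exists r'.
(* Zorn's lemma gives a maximal ideal containing [r]; the empty set is
   admitted in [P] so that empty chains have an upper bound *)
left; pose P := [set K : set R | is_ideal K /\ ~ K 1 /\ K r \/ K = set0].
have [|K [PK maxK]] := @Zorn_bigcup _ P.
  move=> F FP Ftot.
  have [[K0 [FK0 [x0 K0x0]]]|F0] :=
    pselect (exists K, F K /\ K !=set0); last first.
    right; rewrite -subset0 => x [K FK Kx].
    by apply: F0; exists K; split=> //; exists x.
  have FI K x : F K -> K x -> is_ideal K /\ ~ K 1 /\ K r.
    by move=> FK Kx; case: (FP _ FK) => // K0'; rewrite K0' in Kx.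
  left; split; first split.
  - by exists K0 => //; have [[]] := FI _ _ FK0 K0x0.
  - move=> x y [K FK Kx] [L FL Ly].
    have [[_ KD _] _] := FI _ _ FK Kx; have [[_ LD _] _] := FI _ _ FL Ly.
    have [KL|LK] := Ftot _ _ FK FL.
    + by exists L => //; apply: LD => //; apply: KL.
    + by exists K => //; apply: KD => //; apply: LK.
  - move=> a x [K FK Kx]; exists K => //.
    by have [[_ _ KM] _] := FI _ _ FK Kx; apply: KM.
  split; first by case=> K FK K1; have [_ []] := FI _ _ FK K1.
  by exists K0 => //; have [_ []] := FI _ _ FK0 K0x0.
pose rR := [set x | exists a, x = a * r].
have PrR : P rR.
  left; split; first split.
  - by exists 0; rewrite mul0r.
  - by move=> _ _ [a ->] [b ->]; exists (a + b); rewrite mulrDl.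
  - by move=> b _ [a ->]; exists (b * a); rewrite mulrA.
  split; first by case=> a ra; apply: nr; exists a; rewrite mulrC -ra.
  by exists 1; rewrite mul1r.
have [idK [K1 Kr]] : is_ideal K /\ ~ K 1 /\ K r.
  case: PK => // K0; exfalso; apply: (maxK rR) => //.
  rewrite K0; split; first exact: sub0set.
  by move/(_ r); apply; exists 1; rewrite mul1r.
suff maxiK : maximal_ideal K by rewrite -(uniq_m _ maxm) (uniq_m _ maxiK).
split=> // L iL L1 KL; apply: contrapT => LK; apply: (maxK L).
  by split=> // LK'; apply: LK; apply/seteqP.
by left; split=> //; split=> //; apply: KL.
Qed.

(** The two summands are the kernels of the projections of the fiber product to
    its factors. *)
Lemma fiber_product_split :
  local_ring R -> fiber_product_ring R -> exists I J : set R, split_local I J.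
Proof.
move=> locR [S [T [k [pS [pT [f [_ [sS sT] [[s s0 ks] [t t0 kt]] injf fP]]]]]]].
pose I := [set r | (f r).2 = 0]; pose J := [set r | (f r).1 = 0].
pose n := [set r | pS (f r).1 = 0].
have idI : is_ideal I.
  split=> [|x y|a x]; rewrite /I /= ?rmorph0 ?rmorphD ?rmorphM //=.
  - by move=> -> ->; rewrite addr0.
  - by move=> ->; rewrite mulr0.
have idJ : is_ideal J.
  split=> [|x y|a x]; rewrite /J /= ?rmorph0 ?rmorphD ?rmorphM //=.
  - by move=> -> ->; rewrite addr0.
  - by move=> ->; rewrite mulr0.
have pST r : pS (f r).1 = pT (f r).2 by apply/fP; exists r.
have lift0 (s' : S) : pS s' = 0 -> exists r, f r = (s', 0).
  by move=> e; apply/fP; rewrite /= e rmorph0.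
have lift1 (t' : T) : pT t' = 0 -> exists r, f r = (0, t').
  by move=> e; apply/fP; rewrite /= e rmorph0.
have nE : ideal_add I J = n.
  apply/seteqP; split=> r /=.
    move=> [x [y [Ix Jy ->]]]; rewrite /n /= rmorphD /= rmorphD /=.
    by rewrite pST Ix Jy !rmorph0 addr0.
  move=> nr; have [x fx] := lift0 _ nr.
  have [y fy] : exists y, f y = (0, (f r).2) by apply: lift1; rewrite -pST.
  exists x, y; split; rewrite /I /J /= ?fx ?fy //.
  apply: injf; rewrite rmorphD fx fy.
  by rewrite [f r]surjective_pairing; congr pair; rewrite /= ?addr0 ?add0r.
have idn : is_ideal n by rewrite -nE; apply: ideal_add_ideal.
have n1 : ~ n 1 by rewrite /n /= !rmorph1; apply/eqP/oner_neq0.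
have maxn : maximal_ideal n.
  split=> // L [_ LD LM] L1 nL; apply/seteqP; split=> // r Lr.
  apply: contrapT => /eqP nr; apply: L1.
  have [s' ps'] := sS (pS (f r).1)^-1; have [t' pt'] := sT (pS (f r).1)^-1.
  have [r' fr'] : exists r', f r' = (s', t') by apply/fP; rewrite /= ps' pt'.
  rewrite -[1](subrK (r' * r)); apply: LD; last exact: LM.
  apply: nL; rewrite /n /= !(rmorphB, rmorphM, rmorph1) /= fr' ps'.
  by rewrite mulVf // subrr.
exists I, J; split=> //; rewrite ?nE //.
- move=> x Ix Jx; apply: injf; rewrite rmorph0 [f x]surjective_pairing.
  by rewrite Ix Jx.
- have [x fx] := lift0 _ ks; exists x; first by rewrite /I /= fx.
  by apply: contra_neq s0 => x0; move: fx; rewrite x0 rmorph0 => -[].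
- have [x fx] := lift1 _ kt; exists x; first by rewrite /J /= fx.
  by apply: contra_neq t0 => x0; move: fx; rewrite x0 rmorph0 => -[].
- by move=> r; apply: local_ring_inv.
Qed.

End FiberProduct.

(** * Minimal generators and syzygies *)

Section LinearCombinations.
Variables (R : comNzRingType) (L : lmodType R).

(** The linear map from row vectors to [L] given by a family of elements. *)
Definition lincomb q (g : 'I_q -> L) (c : 'rV[R]_q) : L := \sum_j c 0 j *: g j.

Fact lincomb_linear q (g : 'I_q -> L) : linear (lincomb g).
Proof.
move=> a c d; rewrite /lincomb scaler_sumr -big_split.
by apply: eq_bigr => j _; rewrite !mxE scalerDl scalerA.
Qed.

HB.instance Definition _ q (g : 'I_q -> L) :=
  GRing.isLinear.Build R 'rV[R]_q L *:%R (lincomb g) (lincomb_linear g).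

Lemma lincomb_delta q (g : 'I_q -> L) j : lincomb g (delta_mx 0 j) = g j.
Proof.
rewrite /lincomb (bigD1 j) //= mxE !eqxx scale1r big1 ?addr0 // => i /negPf ij.
by rewrite mxE eqxx ij scale0r.
Qed.

End LinearCombinations.

Lemma lincomb_rows (R : comNzRingType) q n (C : 'M[R]_(q, n)) (c : 'rV_q) :
  lincomb (fun j => row j C) c = c *m C.
Proof. by rewrite mulmx_sum_row. Qed.

Section Minimal.
Variables (R : comNzRingType) (I J : set R).
Hypothesis splitIJ : split_local I J.
Let m := ideal_add I J.

Lemma minimal_generators (L : lmodType R) q (g : 'I_q -> L) :
  exists q' (g' : 'I_q' -> L),
    (forall x, (exists c, x = lincomb g c) <-> (exists c, x = lincomb g' c)) /\
    (forall c, lincomb g' c = 0 -> entries_in m c).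
Proof.
elim: q g => [|q IHq] g.
  by exists 0%N, g; split=> // c _ i [].
have [ming|] := pselect (forall c, lincomb g c = 0 -> entries_in m c).
  by exists q.+1, g.
move=> /existsNP[c /not_implyP[gc0 /existsNP[i /existsNP[j cij]]]].
rewrite (ord1 i) {i} in cij.
have [//|[r cr]] := split_inv splitIJ (c 0 j).
(* [g j] is a combination of the other generators *)
have gj : g j = lincomb (fun i => g (lift j i)) (\row_i - (r * c 0 (lift j i))).
  move: gc0; rewrite /lincomb (bigD1_ord j) //= => /eqP.
  rewrite addr_eq0 => /eqP gc0; rewrite -[LHS]scale1r -cr mulrC -scalerA gc0.
  rewrite scalerN scaler_sumr -sumrN; apply: eq_bigr => i _.
  by rewrite mxE scaleNr scalerA.
have [q' [g' [sp' min']]] := IHq (fun i => g (lift j i)).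
exists q', g'; split=> // x; rewrite -sp'; split=> -[d ->].
  exists (d 0 j *: (\row_i - (r * c 0 (lift j i))) + \row_i d 0 (lift j i)).
  rewrite linearP /= -gj /lincomb (bigD1_ord j) //=; congr (_ + _).
  by apply: eq_bigr => i _; rewrite mxE.
exists (\row_i if unlift j i is Some k then d 0 k else 0).
rewrite /lincomb (bigD1_ord j) //= mxE unlift_none scale0r add0r.
by apply: eq_bigr => i _; rewrite mxE liftK.
Qed.

(** The rows of [B] are a minimal system of generators of their span: their
    relations have coefficients in the maximal ideal. *)
Definition minimal_mx b c (B : 'M[R]_(b, c)) : Prop :=
  forall r (V : 'M_(r, b)), V *m B = 0 -> entries_in m V.

Lemma minimal_rowsP b c (B : 'M[R]_(b, c)) :
  (forall v : 'rV_b, v *m B = 0 -> entries_in m v) -> minimal_mx B.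
Proof.
move=> h r V VB0 i j; have /h/(_ 0 j) : row i V *m B = 0.
  by rewrite -row_mul VB0 row0.
by rewrite mxE.
Qed.

Lemma row_factor r b c (V : 'M[R]_(r, b)) (C : 'M[R]_(c, b)) :
  (forall i, exists w, row i V = w *m C) -> exists W, V = W *m C.
Proof.
move=> /choice[w wP]; exists (\matrix_i w i).
by apply/row_matrixP=> i; rewrite row_mul rowK.
Qed.

Lemma minimal_rows b c (B : 'M[R]_(b, c)) :
  exists b' (B' : 'M_(b', c)) P Q,
    [/\ minimal_mx B', B' = P *m B & B = Q *m B'].
Proof.
have [b' [g' [sp min']]] := minimal_generators (fun j => row j B).
pose B' := \matrix_i g' i.
have gE c' : lincomb g' c' = c' *m B'.
  by rewrite -lincomb_rows; apply: eq_bigr => i _; rewrite rowK.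
have [P PE] : exists P, B' = P *m B.
  apply: row_factor => i; have /sp[w wE] : exists w, g' i = lincomb g' w.
    by exists (delta_mx 0 i); rewrite lincomb_delta.
  by exists w; rewrite rowK wE lincomb_rows.
have [Q QE] : exists Q, B = Q *m B'.
  apply: row_factor => i.
  have /sp[w wE] : exists w, row i B = lincomb (fun j => row j B) w.
    by exists (delta_mx 0 i); rewrite lincomb_delta.
  by exists w; rewrite wE gE.
exists b', B', P, Q; split=> //.
by apply: minimal_rowsP => v; rewrite -gE; apply: min'.
Qed.

(** Nakayama's lemma for the module spanned by the rows of [B]. *)
Lemma nakayama b c (B : 'M[R]_(b, c)) (Z : 'M_b) :
  entries_in m Z -> B = Z *m B -> B = 0.
Proof.
move=> mZ BE; have [b' [B' [P [Q [min' PE QE]]]]] := minimal_rows B.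
have idm : is_ideal m := split_max_ideal splitIJ.
case: b' => [|b'] in B' P Q min' PE QE *.
  by rewrite QE (flatmx0 B') mulmx0.
have mU : entries_in m (P *m Z *m Q).
  by apply: entries_in_mulr => //; apply: entries_in_mull.
have m1 : entries_in m (1%:M - P *m Z *m Q).
  by apply: min'; rewrite mulmxBl mul1mx -!mulmxA -QE -BE -PE subrr.
case: (split_proper splitIJ); have := entries_inD idm m1 mU.
by rewrite subrK => /(_ ord0 ord0); rewrite mxE.
Qed.

(** The rows of [C] generate the left kernel of [B]. *)
Definition exact_mx c b a (C : 'M[R]_(c, b)) (B : 'M[R]_(b, a)) : Prop :=
  C *m B = 0 /\ forall r (V : 'M_(r, b)), V *m B = 0 -> exists W, V = W *m C.

Lemma exact_rowsP c b a (C : 'M[R]_(c, b)) (B : 'M[R]_(b, a)) :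
  (forall v : 'rV_b, v *m B = 0 <-> exists w, v = w *m C) -> exact_mx C B.
Proof.
move=> h; split=> [|r V VB0].
  apply/row_matrixP=> i; rewrite row0 row_mul; apply/h.
  by exists (delta_mx 0 i); rewrite -rowE.
by apply: row_factor => i; apply/h; rewrite -row_mul VB0 row0.
Qed.

(** A submodule of a free module of finite rank is finitely generated: its first
    coordinates form an ideal, and the vectors with first coordinate zero are
    handled by induction. *)
Lemma noetherian_submodule n (K : set 'rV[R]_n) :
  noetherian R -> K 0 -> (forall a x y, K x -> K y -> K (a *: x + y)) ->
  exists q (C : 'M_(q, n)), forall x, K x <-> exists c, x = c *m C.
Proof.
move=> noeR; elim: n K => [|n IHn] K K0 KP.
  exists 0%N, 0 => x; rewrite (thinmx0 x); split=> // _.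
  by exists 0; rewrite mul0mx.
pose A : set R := [set a | exists2 x, K x & x 0 0 = a].
have [|s sE] := noeR A.
  split=> [|_ _ [x Kx <-] [y Ky <-]|a _ [x Kx <-]].
  - by exists 0; rewrite ?mxE.
  - by exists (1 *: x + y); [apply: KP | rewrite !mxE mul1r].
  - by exists (a *: x + 0); [apply: KP | rewrite !mxE addr0].
have /choice[y yP] : forall j : 'I_(size s), exists y, K y /\ y 0 0 = s`_j.
  move=> j; have [y Ky yj] : A s`_j.
    rewrite sE; exists (fun i => (i == j)%:R).
    rewrite (bigD1 j) //= eqxx mul1r big1 ?addr0 // => i /negPf ->.
    by rewrite mul0r.
  by exists y.
pose Y := \matrix_j y j.
have KD x x' : K x -> K x' -> K (x + x').
  by move=> Kx Kx'; rewrite -[x]scale1r; apply: KP.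
have KZ a x : K x -> K (a *: x) by move=> Kx; rewrite -[_ *: _]addr0; apply: KP.
have KY c : K (c *m Y).
  rewrite mulmx_sum_row; apply: (big_ind K) => // j _.
  by apply: KZ; rewrite rowK; have [] := yP j.
have [||q [C CP]] := IHn [set x : 'rV_n | K (row_mx (0 : 'rV_1) x)].
- by rewrite /= row_mx0.
- move=> a u v Ku Kv /=.
  have -> : row_mx 0 (a *: u + v) = a *: row_mx (0 : 'rV_1) u + row_mx 0 v.
    by rewrite scale_row_mx add_row_mx scaler0 addr0.
  exact: KP.
have rowCE (d : 'rV_q) :
    d *m row_mx (0 : 'cV_q) C = row_mx (0 : 'rV_1) (d *m C) :> 'rV_(1 + n).
  by rewrite mul_mx_row mulmx0.
exists (size s + q)%N, (col_mx Y (row_mx (0 : 'cV_q) C)) => x; split.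
  move=> Kx; have : A (x 0 0) by exists x.
  rewrite sE => -[c cE]; pose c' := \row_j c j.
  have x0 : (x - c' *m Y) 0 0 = 0.
    rewrite !mxE cE; apply/eqP; rewrite subr_eq0; apply/eqP/eq_bigr => j _.
    by rewrite !mxE; have [_ ->] := yP j.
  have xE : x - c' *m Y =
      row_mx (0 : 'rV_1) (rsubmx (x - c' *m Y : 'rV_(1 + n))).
    apply: etrans (esym (@hsubmxK _ 1 1 n _)) _; congr (@row_mx _ 1 1 n _ _).
    apply/rowP=> i; rewrite ord1 [LHS]mxE [RHS]mxE -[RHS]x0.
    by congr (fun_of_matrix _ _ _); apply/val_inj.
  have : K (x - c' *m Y).
    by apply: KD => //; rewrite -scaleN1r; apply: KZ.
  rewrite xE => /CP[d dE].
  exists (row_mx c' d); by rewrite mul_row_col rowCE -dE -xE addrC subrK.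
move=> [c ->]; rewrite -[c]hsubmxK mul_row_col; apply: KD; first exact: KY.
by rewrite rowCE; apply/CP; exists (rsubmx c).
Qed.

Lemma syzygy_exists b a (B : 'M[R]_(b, a)) :
  noetherian R -> exists c (C : 'M_(c, b)), exact_mx C B /\ minimal_mx C.
Proof.
move=> noeR.
have [||q [C0 C0P]] := @noetherian_submodule b [set v | v *m B = 0] noeR.
- by rewrite /= mul0mx.
- move=> x u v /= uB vB; by rewrite mulmxDl -scalemxAl uB vB scaler0 addr0.
have [c [C [P [Q [minC CE C0E]]]]] := minimal_rows C0.
exists c, C; split=> //; apply: exact_rowsP => v.
apply: (iff_trans (C0P v)); split=> -[w ->].
  by rewrite {1}C0E mulmxA; exists (w *m Q).
by rewrite CE mulmxA; exists (w *m P).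
Qed.

End Minimal.

(** * Second syzygies over a ring with decomposable maximal ideal *)

Section SecondSyzygies.
Variables (R : comNzRingType) (I J : set R).
Hypothesis splitIJ : split_local I J.
Let m := ideal_add I J.

Lemma minimal_mxC b c (B : 'M[R]_(b, c)) : minimal_mx I J B -> minimal_mx J I B.
Proof. by rewrite /minimal_mx ideal_addC. Qed.

(** The left kernel of a minimal matrix is the direct sum of its vectors with
    entries in [I] and its vectors with entries in [J], since [I] and [J] are
    ideals with zero intersection. *)
Lemma kernel_split r b a (V : 'M[R]_(r, b)) (B : 'M[R]_(b, a)) :
  minimal_mx I J B -> V *m B = 0 ->
  exists V1 V2, [/\ entries_in I V1, entries_in J V2, V = V1 + V2,
                    V1 *m B = 0 & V2 *m B = 0].
Proof.
move=> minB VB0; have [V1 [V2 [IV1 JV2 VE]]] := entries_in_split (minB _ _ VB0).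
have V12 : V1 *m B = - (V2 *m B).
  by apply/eqP; rewrite -addr_eq0 -mulmxDl -VE VB0.
have [iI iJ] := (splitl_ideal splitIJ, splitr_ideal splitIJ).
have V10 : V1 *m B = 0.
  apply: (split_capmx splitIJ); first exact: entries_in_mulr.
  by rewrite V12; apply: entries_inN => //; apply: entries_in_mulr.
exists V1, V2; split=> //.
by apply/eqP; rewrite -oppr_eq0 -V12 V10.
Qed.

(** Nakayama's lemma for the [J]-part of a second syzygy: this part is zero if
    it is contained in the maximal ideal times the whole syzygy. *)
Lemma nakayama_right c b a (C : 'M[R]_(c, b)) (B : 'M[R]_(b, a)) :
  minimal_mx I J B -> exact_mx C B ->
  (forall v : 'rV_b, entries_in J v -> v *m B = 0 ->
     exists2 z, entries_in m z & v = z *m C) ->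
  forall v : 'rV_b, entries_in J v -> v *m B = 0 -> v = 0.
Proof.
move=> minB [CB0 exCB] h v Jv vB0.
have [C1 [C2 [IC1 JC2 CE _ C2B0]]] := kernel_split minB CB0.
have [iI iJ] := (splitl_ideal splitIJ, splitr_ideal splitIJ).
have /choice[z zP] : forall i, exists z, entries_in m z /\ row i C2 = z *m C.
  move=> i; have [j k||z mz zE] := h (row i C2); first by rewrite mxE.
    by rewrite -row_mul C2B0 row0.
  by exists z.
pose Z := \matrix_i z i.
have ZE : C2 = Z *m C1 + Z *m C2.
  rewrite -mulmxDr -CE; apply/row_matrixP=> i.
  by rewrite row_mul rowK; case: (zP i).
have C20 : C2 = 0.
  apply: (nakayama splitIJ (Z := Z)) => [i j|].
    by rewrite mxE; have [mz _] := zP i; apply: mz.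
  have ZC : Z *m C1 = C2 - Z *m C2 by rewrite {1}ZE addrK.
  rewrite {1}ZE (split_capmx splitIJ (A := Z *m C1)) ?add0r //.
    exact: entries_in_mull.
  rewrite ZC; apply: entries_inD => //; apply: entries_inN => //.
  exact: entries_in_mull.
have [w wE] := exCB _ _ vB0; apply: (split_capmx splitIJ) => //.
by rewrite wE CE C20 addr0; apply: entries_in_mull.
Qed.

(** A nonzero [J]-part of a second syzygy contains a minimal generator of that
    syzygy, and this generator is killed by [I]. *)
Lemma unit_vector_right c b a (C : 'M[R]_(c, b)) (B : 'M[R]_(b, a))
    (x : 'rV_b) :
  minimal_mx I J B -> exact_mx C B -> entries_in J x -> x *m B = 0 -> x != 0 ->
  exists (u : 'rV_c) j, u 0 j = 1 /\ forall a, I a -> (a *: u) *m C = 0.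
Proof.
move=> minB exCB Jx xB0 /eqP x0; apply: contrapT => nu; apply: x0.
apply: (nakayama_right minB exCB _ Jx xB0) => v Jv vB0.
have [u uE] := exCB.2 _ _ vB0; exists u => // i j; rewrite ord1 {i}.
have [//|[r ur]] := split_inv splitIJ (u 0 j).
exfalso; apply: nu; exists (r *: u), j; split; first by rewrite mxE mulrC.
move=> t It; rewrite -2!scalemxAl -uE; apply/matrixP=> i k; rewrite !mxE mulrCA.
by rewrite (split_mul0 splitIJ It (Jv i k)) mulr0.
Qed.

End SecondSyzygies.

Section TorTrivial.
Variable R : comNzRingType.

(** The vanishing of Tor_1 of the cokernels of [B] and [D]: a matrix whose
    columns are combinations of the rows of [B] and whose rows are combinations
    of the rows of [D] is a sum of products of such columns and rows. *)
Definition tor_trivial b1 b0 d1 d0 (B : 'M[R]_(b1, b0)) (D : 'M[R]_(d1, d0)) :=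
  forall (V : 'M_(b1, d0)) (U : 'M_(b0, d1)), B^T *m V = U *m D ->
  exists W : 'M_(b1, d1), U *m D = B^T *m W *m D.

(** Passing to the first syzygy on the left and undoing it on the right. *)
Lemma tor_trivial_shift b2 b1 b0 d2 d1 d0 (B1 : 'M[R]_(b2, b1))
    (B0 : 'M[R]_(b1, b0)) (D1 : 'M[R]_(d2, d1)) (D0 : 'M[R]_(d1, d0)) :
  exact_mx B1 B0 -> exact_mx D1 D0 -> tor_trivial B0 D1 -> tor_trivial B1 D0.
Proof.
move=> [B10 exB] [D10 exD] t V U VU.
have [|S SE] := exD _ (B0^T *m U).
  by rewrite -mulmxA -VU mulmxA -trmx_mul B10 trmx0 mul0mx.
have [W WE] := t U S SE.
have [|W' W'E] := exB _ (U - W *m D1)^T.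
  by rewrite -[B0]trmxK -trmx_mul mulmxBr SE WE mulmxA subrr trmx0.
exists W'^T; rewrite -trmx_mul -W'E trmxK mulmxBl -(mulmxA W) D10 mulmx0 subr0.
by [].
Qed.

Section Contradiction.
Variables (I J : set R).
Variables (b0 b1 b2 b3 d0 d1 d2 d3 : nat).
Variables (B0 : 'M[R]_(b1, b0)) (B1 : 'M[R]_(b2, b1)) (B2 : 'M[R]_(b3, b2)).
Variables (D0 : 'M[R]_(d1, d0)) (D1 : 'M[R]_(d2, d1)) (D2 : 'M[R]_(d3, d2)).

(** The assumptions [tor_trivial B1 D2] and [tor_trivial B2 D2] say that Tor_1
    of the second syzygy of the cokernel of [D0] with the first and with the
    second syzygy of the cokernel of [B0] is zero. *)
Lemma tor_trivial_left : split_local I J ->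
  minimal_mx I J B0 -> minimal_mx I J B1 -> minimal_mx I J D0 ->
  minimal_mx I J D1 -> exact_mx B1 B0 -> exact_mx B2 B1 -> exact_mx D1 D0 ->
  exact_mx D2 D1 -> tor_trivial B1 D2 -> tor_trivial B2 D2 -> B1 != 0 ->
  forall x : 'rV_d1, entries_in I x -> x *m D0 = 0 -> x = 0.
Proof.
move=> splitIJ minB0 minB1 minD0 minD1 exB1 exB2 exD1 exD2 t1 t2 B1n0 x Ix xD0.
apply: contrapT => /eqP x0.
have idm := split_max_ideal splitIJ.
have [u [j [uj1 uJ]]] :=
  unit_vector_right (split_localC splitIJ) (minimal_mxC minD0) exD1 Ix xD0 x0.
have mD2 : entries_in (ideal_add I J) D2 := minD1 _ _ exD2.1.
have mB2 : entries_in (ideal_add I J) B2 := minB1 _ _ exB2.1.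
(* [tor_trivial] is applied to [c^T *m u], which has its columns in the span
   of the rows of [B1] and its rows in that of the rows of [D2] *)
have B0J : forall c : 'rV_b1, entries_in J c -> c *m B0 = 0 -> c = 0.
  apply: (nakayama_right splitIJ minB0 exB1) => c Jc cB0.
  have [y yE] := exB1.2 _ _ cB0.
  have [|U UE] := exD2.2 _ (c^T *m u).
    apply/row_matrixP=> i; rewrite row0 row_mul; have := uJ _ (Jc 0 i).
    by congr (_ *m _ = _); apply/rowP=> k; rewrite !mxE big_ord1 !mxE.
  have [|W WE] := t1 (y^T *m u) U; first by rewrite -UE mulmxA -trmx_mul -yE.
  pose ej : 'cV[R]_d2 := delta_mx j 0.
  exists (W *m D2 *m ej)^T.
    move=> i k; rewrite mxE.
    by apply: entries_in_mulr => //; apply: entries_in_mull.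
  apply: trmx_inj; rewrite trmx_mul trmxK !mulmxA -WE -UE -mulmxA.
  suff -> : u *m ej = 1%:M by rewrite mulmx1.
  by rewrite -colE; apply/rowP=> k; rewrite !ord1 !mxE uj1 eqxx.
have IB1 : entries_in I B1.
  have [B1' [B1'' [IB JB -> _ B0'']]] := kernel_split splitIJ minB0 exB1.1.
  suff -> : B1'' = 0 by rewrite addr0.
  apply/row_matrixP=> i; rewrite row0; apply: B0J.
    by move=> k l; rewrite mxE.
  by rewrite -row_mul B0'' row0.
have [i0 _] : exists i0 : 'I_b2, true.
  case: (posnP b2) => [b20|b2_gt0]; last by exists (Ordinal b2_gt0).
  case/eqP: B1n0; apply/matrixP=> i; have := ltn_ord i.
  by rewrite [X in (_ < X)%N]b20.
pose e : 'rV[R]_b2 := delta_mx 0 i0.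
(* the same argument for [e^T *m f], with the two sides exchanged *)
have D1J : forall f : 'rV_d2, entries_in J f -> f *m D1 = 0 -> f = 0.
  apply: (nakayama_right splitIJ minD1 exD2) => f Jf fD1.
  have [y yE] := exD2.2 _ _ fD1.
  have [|V VE] := exB2.2 _ (e^T *m f)^T.
    rewrite trmx_mul trmxK -mulmxA.
    apply: (split_mulmx0 (split_localC splitIJ)).
      by move=> i k; rewrite mxE.
    exact: entries_in_mull (splitl_ideal splitIJ) IB1.
  have efE : e^T *m f = B2^T *m V^T by rewrite -trmx_mul -VE trmxK.
  have [|W WE] := t2 V^T (e^T *m y); first by rewrite -efE yE mulmxA.
  exists (e *m B2^T *m W).
    apply: entries_in_mulr => //; apply: entries_in_mull => //.
    by move=> i k; rewrite mxE.
  rewrite -!mulmxA (mulmxA _ W) -WE -mulmxA -yE mulmxA.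
  suff -> : e *m e^T = 1%:M by rewrite mul1mx.
  by rewrite trmx_delta mul_delta_mx; apply/rowP=> k; rewrite !ord1 !mxE.
have [a Ja] := splitr_neq0 splitIJ; case/eqP.
have au0 : a *: u = 0.
  apply: D1J (uJ a Ja) => i k; rewrite mxE.
  exact: ideal_mulr (splitr_ideal splitIJ) Ja.
by have := congr1 (fun v : 'rV_d2 => v 0 j) au0; rewrite !mxE uj1 mulr1.
Qed.

End Contradiction.

(** By [tor_trivial_left] for [I], [J] and for [J], [I], one of the two second
    syzygies is zero. *)
Lemma tor_trivial_syzygy I J b0 b1 b2 b3 d0 d1 d2 d3
    (B0 : 'M[R]_(b1, b0)) (B1 : 'M[R]_(b2, b1)) (B2 : 'M[R]_(b3, b2))
    (D0 : 'M[R]_(d1, d0)) (D1 : 'M[R]_(d2, d1)) (D2 : 'M[R]_(d3, d2)) :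
  split_local I J ->
  minimal_mx I J B0 -> minimal_mx I J B1 -> minimal_mx I J D0 ->
  minimal_mx I J D1 -> exact_mx B1 B0 -> exact_mx B2 B1 -> exact_mx D1 D0 ->
  exact_mx D2 D1 -> tor_trivial B1 D2 -> tor_trivial B2 D2 -> B1 = 0 \/ D1 = 0.
Proof.
move=> splitIJ minB0 minB1 minD0 minD1 exB1 exB2 exD1 exD2 t1 t2.
have [->|B1n0] := eqVneq B1 0; [by left | right].
have [V1 [V2 [IV1 JV2 -> V1D0 V2D0]]] := kernel_split splitIJ minD0 exD1.1.
have {V1D0} -> : V1 = 0.
  apply/row_matrixP=> i; rewrite row0.
  apply: (tor_trivial_left splitIJ minB0 minB1 minD0 minD1 exB1 exB2 exD1 exD2
            t1 t2 B1n0).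
    by move=> k l; rewrite mxE.
  by rewrite -row_mul V1D0 row0.
rewrite add0r; apply/row_matrixP=> i; rewrite row0.
apply: (tor_trivial_left (split_localC splitIJ) (minimal_mxC minB0)
          (minimal_mxC minB1) (minimal_mxC minD0) (minimal_mxC minD1)
          exB1 exB2 exD1 exD2 t1 t2 B1n0).
  by move=> k l; rewrite mxE.
by rewrite -row_mul V2D0 row0.
Qed.

End TorTrivial.

(** * Kernels and cokernels *)

Section Kernel.
Variables (R : comNzRingType) (A B : lmodType R) (h : {linear A -> B}).

Definition ker_pred : {pred A} := [pred x | h x == 0].

Fact ker_submod_closed : submod_closed ker_pred.
Proof.
split=> [|a x y]; rewrite !inE ?linear0 // => /eqP hx /eqP hy.
by rewrite linearP hx hy scaler0 addr0.
Qed.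

HB.instance Definition _ :=
  GRing.isSubmodClosed.Build R A ker_pred ker_submod_closed.

(** The kernel of a linear map, as a module. *)
Record kernel := Kernel { ker_val :> A; _ : ker_val \in ker_pred }.

HB.instance Definition _ := [isSub for ker_val].
HB.instance Definition _ := [Choice of kernel by <:].
HB.instance Definition _ := [SubChoice_isSubLmodule of kernel by <:].

End Kernel.

Section Cokernel.
Variables (R : comNzRingType) (A B : lmodType R) (h : {linear A -> B}).

Definition coker_rel (x y : B) : bool := `[< exists a, x - y = h a >].

Fact coker_relP x y : reflect (exists a, x - y = h a) (coker_rel x y).
Proof. exact: asboolP. Qed.

Fact coker_equiv_class : equiv_class_of coker_rel.
Proof.
split=> [x|x y|y x z].
- by apply/coker_relP; exists 0; rewrite subrr linear0.
- apply/coker_relP/coker_relP=> -[a e]; exists (- a).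
    by rewrite linearN -e opprB.
  by rewrite linearN -e opprB.
- move=> /coker_relP[a ea] /coker_relP[b eb]; apply/coker_relP.
  by exists (a + b); rewrite linearD -ea -eb addrA subrK.
Qed.

Canonical coker_equiv := EquivRelPack coker_equiv_class.

(** The cokernel of a linear map, as a module. *)
Definition coker := {eq_quot coker_equiv}.

HB.instance Definition _ := Choice.on coker.
HB.instance Definition _ := EqQuotient.on coker.

Fact coker_piP x y : \pi_coker x = \pi_coker y <-> exists a, x - y = h a.
Proof.
split=> [/eqmodP/coker_relP //|e].
by apply/eqmodP/coker_relP.
Qed.

Fact coker_repr x : exists a, repr (\pi_coker x) = x + h a.
Proof.
have /coker_piP[a e] : \pi_coker (repr (\pi_coker x)) = \pi_coker x.
  by rewrite reprK.
by exists a; rewrite -e addrC subrK.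
Qed.

Definition coker_add (x y : coker) : coker := \pi_coker (repr x + repr y).
Definition coker_scale (a : R) (x : coker) : coker := \pi_coker (a *: repr x).
Definition coker_zero : coker := \pi_coker 0.
Definition coker_opp (x : coker) : coker := \pi_coker (- repr x).

Fact coker_addE x y : coker_add (\pi_coker x) (\pi_coker y) = \pi_coker (x + y).
Proof.
have [[a ax] [b bx]] := (coker_repr x, coker_repr y).
apply/coker_piP; exists (a + b).
by rewrite ax bx linearD addrACA; apply/eqP; rewrite subr_eq addrC.
Qed.

Fact coker_scaleE a x : coker_scale a (\pi_coker x) = \pi_coker (a *: x).
Proof.
have [b bx] := coker_repr x; apply/coker_piP; exists (a *: b).
by rewrite bx [h (a *: b)]linearZ_LR scalerDr; apply/eqP; rewrite subr_eq addrC.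
Qed.

Fact coker_oppE x : coker_opp (\pi_coker x) = \pi_coker (- x).
Proof.
have [b bx] := coker_repr x; apply/coker_piP; exists (- b).
by rewrite bx [h (- b)]linearN opprD; apply/eqP; rewrite subr_eq addrC.
Qed.

Fact coker_reprP (x : coker) : exists y, x = \pi_coker y.
Proof. by exists (repr x); rewrite reprK. Qed.

Fact coker_addA : associative coker_add.
Proof.
move=> x y z; have [x' ->] := coker_reprP x; have [y' ->] := coker_reprP y.
by have [z' ->] := coker_reprP z; rewrite !coker_addE addrA.
Qed.
Fact coker_addC : commutative coker_add.
Proof. by move=> x y; rewrite /coker_add addrC. Qed.
Fact coker_add0 : left_id coker_zero coker_add.
Proof.
by move=> x; have [x' ->] := coker_reprP x; rewrite coker_addE add0r.
Qed.
Fact coker_addN : left_inverse coker_zero coker_opp coker_add.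
Proof.
move=> x; have [x' ->] := coker_reprP x.
by rewrite coker_oppE coker_addE addNr.
Qed.

HB.instance Definition _ := GRing.isZmodule.Build coker
  coker_addA coker_addC coker_add0 coker_addN.

Fact coker_scaleA a b x :
  coker_scale a (coker_scale b x) = coker_scale (a * b) x.
Proof. by have [x' ->] := coker_reprP x; rewrite !coker_scaleE scalerA. Qed.
Fact coker_scale1 : left_id 1 coker_scale.
Proof.
by move=> x; have [x' ->] := coker_reprP x; rewrite coker_scaleE scale1r.
Qed.
Fact coker_scaleDr : right_distributive coker_scale +%R.
Proof.
move=> a x y; have [[x' ->] [y' ->]] := (coker_reprP x, coker_reprP y).
rewrite -[LHS]/(coker_scale a (coker_add _ _)) -[RHS]/(coker_add _ _).
by rewrite coker_addE !coker_scaleE coker_addE scalerDr.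
Qed.
Fact coker_scaleDl x : {morph coker_scale^~ x : a b / a + b}.
Proof.
move=> a b; have [x' ->] := coker_reprP x; rewrite -[RHS]/(coker_add _ _).
by rewrite !coker_scaleE coker_addE scalerDl.
Qed.

HB.instance Definition _ := GRing.Zmodule_isLmodule.Build R coker
  coker_scaleA coker_scale1 coker_scaleDr coker_scaleDl.

Definition coker_pi (x : B) : coker := \pi_coker x.

Fact coker_pi_linear : linear coker_pi.
Proof.
move=> a x y; rewrite /coker_pi -[RHS]/(coker_add (coker_scale _ _) _).
by rewrite coker_scaleE coker_addE.
Qed.

HB.instance Definition _ :=
  GRing.isLinear.Build R B coker *:%R coker_pi coker_pi_linear.

Lemma coker_pi_surj : surjective_map coker_pi.
Proof. by move=> y; exists (repr y); apply: reprK. Qed.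

Lemma coker_pi_eq0 x : coker_pi x = 0 <-> exists a, x = h a.
Proof.
rewrite -[0]/(\pi_coker 0); apply: (iff_trans (coker_piP _ _)).
by split=> -[a]; exists a; rewrite ?subr0 // -[x]subr0.
Qed.

End Cokernel.

(** * Comparison of projective resolutions *)

Section Comparison.
Variable R : comNzRingType.

(** A projective module lifts maps along an exact pair. *)
Lemma projective_lift (P A B C : lmodType R) (g : {linear A -> B})
    (h : {linear B -> C}) (f : {linear P -> B}) :
  projective P -> exact g h -> (forall x, h (f x) = 0) ->
  exists k : {linear P -> A}, forall x, g (k x) = f x.
Proof.
move=> projP gh hf.
have gK a : g a \in ker_pred h by rewrite inE; apply/eqP/gh; exists a.
have fK x : f x \in ker_pred h by rewrite inE hf.
pose g' a : kernel h := Kernel (gK a); pose f' x : kernel h := Kernel (fK x).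
have g'lin : linear g' by move=> a x y; apply: val_inj; rewrite /= linearP.
have f'lin : linear f' by move=> a x y; apply: val_inj; rewrite /= linearP.
pose G := GRing.isLinear.Build _ _ _ _ g' g'lin.
pose F := GRing.isLinear.Build _ _ _ _ f' f'lin.
pose gL : {linear A -> kernel h} := HB.pack g' G.
pose fL : {linear P -> kernel h} := HB.pack f' F.
have [|k kP] := projP A (kernel h) gL fL.
  case=> y yK; have [a ga] : exists a, g a = y by apply/gh/eqP.
  by exists a; apply: val_inj.
by exists k => x; have := congr1 val (kP x).
Qed.

Variables (M : lmodType R).
Implicit Types P Q : proj_resolution M.

(** The cycles of the resolution, augmented by [M]. *)
Definition cycle P n : P n -> Prop :=
  match n with
  | 0 => fun x => res_aug P x = 0
  | n'.+1 => fun x => res_d P n' x = 0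
  end.

Lemma cycleP P n (x : P n) : cycle x <-> exists y, res_d P n y = x.
Proof.
case: n x => [|n] x; [exact: res_aug_exact | exact: res_d_exact].
Qed.

Lemma cycle_lift (A : lmodType R) Q n (f : {linear A -> Q n}) :
  projective A -> (forall x, cycle (f x)) ->
  exists k : {linear A -> Q n.+1}, forall x, res_d Q n (k x) = f x.
Proof.
case: n f => [|n] f projA fP.
  exact: projective_lift projA (@res_aug_exact _ _ Q) fP.
exact: projective_lift projA (@res_d_exact _ _ Q n) fP.
Qed.

Lemma chain_map P Q : exists f : forall n, {linear P n -> Q n},
  (forall x, res_aug Q (f 0%N x) = res_aug P x) /\
  (forall n x, res_d Q n (f n.+1 x) = f n (res_d P n x)).
Proof.
pose cm n := {f : {linear P n -> Q n} | forall x, cycle x -> cycle (f x)}.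
have [f0 f0P] : exists f : {linear P 0%N -> Q 0%N},
    forall x, res_aug Q (f x) = res_aug P x.
  exact: (@res_projective _ _ P 0%N) (@res_aug_surj _ _ Q).
have step n (f : cm n) : exists k : cm n.+1,
    forall x, res_d Q n (sval k x) = sval f (res_d P n x).
  have [x|k kP] := cycle_lift (f := sval f \o res_d P n)
      (@res_projective _ _ P n.+1).
    by apply: (svalP f); apply/cycleP; exists x.
  have kcyc x : cycle x -> cycle (k x).
    by rewrite /= kP /= => ->; rewrite linear0.
  by exists (exist _ k kcyc).
have f0cyc x : cycle x -> cycle (f0 x) by rewrite /= f0P.
pose F := fix F n : cm n := match n with
  | 0 => exist _ f0 f0cyc
  | n'.+1 => sval (cid (step n' (F n')))
  end.
by exists (fun n => sval (F n)); split=> // n x /=; case: cid.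
Qed.

(** A chain endomorphism of a projective resolution that lifts the identity is
    homotopic to the identity in positive degrees. *)
Lemma homotopy Q (f : forall n, {linear Q n -> Q n}) n :
  (forall x, res_aug Q (f 0%N x) = res_aug Q x) ->
  (forall n x, res_d Q n (f n.+1 x) = f n (res_d Q n x)) ->
  exists (h : {linear Q n -> Q n.+1}) (h' : {linear Q n.+1 -> Q n.+2}),
    forall x, x - f n.+1 x = res_d Q n.+1 (h' x) + h (res_d Q n x).
Proof.
move=> f0 fd.
suff [h hP] : exists h : {linear Q n -> Q n.+1},
    forall x, cycle x -> res_d Q n (h x) = x - f n x.
  have [x|h' h'P] := cycle_lift (f := (idfun \- f n.+1) \- (h \o res_d Q n))
      (@res_projective _ _ Q n.+1).
    rewrite /= !linearB /= hP; last by apply/cycleP; exists x.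
    by rewrite fd subrr.
  by exists h, h' => x; rewrite h'P /= subrK.
elim: n => [|n [h hP]].
  have [x|h hP] := projective_lift (f := idfun \- f 0%N)
      (@res_projective _ _ Q 0%N) (@res_aug_exact _ _ Q).
    by rewrite /= linearB f0 subrr.
  by exists h => x _; rewrite hP.
have [x|h' h'P] := cycle_lift (f := (idfun \- f n.+1) \- (h \o res_d Q n))
      (@res_projective _ _ Q n.+1).
  rewrite /= !linearB /= hP; last by apply/cycleP; exists x.
  by rewrite fd subrr.
by exists h' => x /= dx; rewrite h'P /= dx linear0 subr0.
Qed.

(** The part around a positive degree of a homotopy equivalence between two
    projective resolutions; [g] and [f] are the maps in that degree. *)
Lemma resolution_homotopy P Q n :
  exists (f : {linear P n.+1 -> Q n.+1}) (g : {linear Q n.+1 -> P n.+1})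
         (f0 : {linear P n -> Q n}) (g0 : {linear Q n -> P n})
         (f1 : {linear P n.+2 -> Q n.+2})
         (h : {linear Q n -> Q n.+1}) (h' : {linear Q n.+1 -> Q n.+2}),
  [/\ forall x, res_d Q n (f x) = f0 (res_d P n x),
      forall x, res_d P n (g x) = g0 (res_d Q n x),
      forall x, res_d Q n.+1 (f1 x) = f (res_d P n.+1 x) &
      forall x, x - f (g x) = res_d Q n.+1 (h' x) + h (res_d Q n x)].
Proof.
have [f [f0 fd]] := chain_map P Q; have [g [g0 gd]] := chain_map Q P.
have [|k x|h [h' hP]] := @homotopy Q (fun n => f n \o g n) n.
- by move=> x; rewrite /= f0 g0.
- by rewrite /= fd gd.
by exists (f n.+1), (g n.+1), (f n), (g n), (f n.+2), h, h'; split.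
Qed.

Lemma Ext_eq0_any (N : lmodType R) n Q : Ext_eq0 n.+1 M N ->
  forall f : {linear Q n.+1 -> N}, (forall x, f (res_d Q n.+1 x) = 0) ->
  exists g : {linear Q n -> N}, forall x, f x = g (res_d Q n x).
Proof.
move=> [P extP] f fd.
have [k [l [k0 [l0 [k1 [h [h' [kd ld k1d hP]]]]]]]] :=
  resolution_homotopy P Q n.
have [x|g gP] := extP (f \o k) _; first by rewrite /= -k1d fd.
exists ((g \o l0) \+ (f \o h)) => x /=.
rewrite -ld -gP /= -[in LHS](subrK (k (l x)) x) hP !linearD /= fd add0r.
by rewrite addrC.
Qed.

Lemma tensor_ind (A B : lmodType R) (K : tensor A B -> Prop) :
  K 0 -> (forall s t, K s -> K t -> K (s + t)) ->
  (forall x y, K (tensor_pure x y)) -> forall t, K t.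
Proof.
by move=> K0 KD Kp t; rewrite (tensor_pure_gen t); apply: (big_ind K) => // p _.
Qed.

Lemma Tor_eq0_any (Z : lmodType R) n Q : Tor_eq0 n.+1 M Z ->
  exact (tensor_map Z (res_d Q n.+1)) (tensor_map Z (res_d Q n)).
Proof.
move=> [P torP].
have [k [l [k0 [l0 [k1 [h [h' [kd ld k1d hP]]]]]]]] :=
  resolution_homotopy P Q n.
move=> y; split=> [dy|[x <-]]; last first.
  elim/tensor_ind: x => [|s t es et|a b];
    rewrite ?linear0 ?linearD /= ?es ?et //.
    by rewrite addr0.
  rewrite !tensor_mapE; suff -> : res_d Q n (res_d Q n.+1 a) = 0.
    by rewrite linear0l.
  by apply/res_d_exact; exists a.
have hT t : t - tensor_map Z k (tensor_map Z l t) =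
    tensor_map Z (res_d Q n.+1) (tensor_map Z h' t)
    + tensor_map Z h (tensor_map Z (res_d Q n) t).
  elim/tensor_ind: t => [|s t es et|a b].
  - by rewrite !linear0 !addr0.
  - by rewrite !linearD /= addrACA es et addrACA.
  - by rewrite !tensor_mapE -linearBl hP linearDl.
have lT t : tensor_map Z (res_d P n) (tensor_map Z l t) =
    tensor_map Z l0 (tensor_map Z (res_d Q n) t).
  elim/tensor_ind: t => [|s t es et|a b];
    rewrite ?linear0 ?linearD /= ?es ?et //.
  by rewrite !tensor_mapE ld.
have kT t : tensor_map Z (res_d Q n.+1) (tensor_map Z k1 t) =
    tensor_map Z k (tensor_map Z (res_d P n.+1) t).
  elim/tensor_ind: t => [|s t es et|a b];
    rewrite ?linear0 ?linearD /= ?es ?et //.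
  by rewrite !tensor_mapE k1d.
have [x xE] : exists x, tensor_map Z (res_d P n.+1) x = tensor_map Z l y.
  by apply/torP; rewrite lT dy linear0.
exists (tensor_map Z h' y + tensor_map Z k1 x).
rewrite linearD /= kT xE -[RHS](subrK (tensor_map Z k (tensor_map Z l y))) hT.
by rewrite dy linear0 addr0.
Qed.

End Comparison.

(** * Minimal free resolutions *)

(** Right multiplication of row vectors by a matrix. *)
Local Notation row_map := (@mulmxr _ 1%N _ _).

Section MinimalResolution.
Variables (R : comNzRingType) (I J : set R).

(** [D] and [g] are the differentials and the augmentation of a minimal free
    resolution of [M], the free modules being modules of row vectors. *)
Record minimal_resolution (M : lmodType R) (q : nat -> nat)
    (D : forall n, 'M[R]_(q n.+1, q n)) (g : 'I_(q 0) -> M) : Prop :=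
  MinimalResolution {
    minres_gen : surjective_map (lincomb g);
    minres_aug : forall c, lincomb g c = 0 <-> exists w, w *m D 0 = c;
    minres_aug_min : forall c, lincomb g c = 0 -> entries_in (ideal_add I J) c;
    minres_exact : forall n, exact_mx (D n.+1) (D n);
    minres_min : forall n, minimal_mx I J (D n) }.

Lemma minimal_resolution_exists (M : lmodType R) :
  split_local I J -> noetherian R -> fin_gen M ->
  exists q (D : forall n, 'M_(q n.+1, q n)) (g : 'I_(q 0) -> M),
    minimal_resolution D g.
Proof.
move=> splitIJ noeR [n [g0 g0P]].
have [q0 [g [sp min_g]]] := minimal_generators splitIJ g0.
have [||q1' [C CP]] :=
  @noetherian_submodule _ q0 [set c | lincomb g c = 0] noeR.
- by rewrite /= linear0.
- by move=> a x y /= gx gy; rewrite linearP /= gx gy scaler0 addr0.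
have [q1 [D0 [P [Q [minD0 D0E CE]]]]] := minimal_rows splitIJ C.
pose mx := {ab : nat * nat & 'M[R]_(ab.2, ab.1)}.
have syz (s : mx) : {c : nat & {C : 'M[R]_(c, (tag s).2) |
    exact_mx C (tagged s) /\ minimal_mx I J C}}.
  case/cid: (syzygy_exists splitIJ (tagged s) noeR) => c /cid[B BP].
  by exists c, B.
pose next (s : mx) : mx :=
  existT (fun ab : nat * nat => 'M[R]_(ab.2, ab.1)) ((tag s).2, tag (syz s))
    (sval (tagged (syz s))).
pose F := fix F n : mx := match n with
  | 0 => existT (fun ab : nat * nat => 'M[R]_(ab.2, ab.1)) (q0, q1) D0
  | n'.+1 => next (F n')
  end.
exists (fun n => (tag (F n)).1), (fun n => tagged (F n)), g; split.
- move=> x; have /sp[c ->] : exists c, x = lincomb g0 c.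
    have [c ->] := g0P x; exists (\row_i c i).
    by apply: eq_bigr => i _; rewrite mxE.
  by exists c.
- move=> c; apply: (iff_trans (CP c)); split=> -[w].
    by move=> ->; exists (w *m Q); rewrite CE mulmxA.
  by move=> <-; rewrite /= D0E mulmxA; exists (w *m P).
- exact: min_g.
- by move=> k; have [] := svalP (tagged (syz (F k))).
- case=> [|k]; first exact: minD0.
  by have [] := svalP (tagged (syz (F k))).
Qed.

Lemma free_projective n : projective 'rV[R]_n.
Proof.
move=> A B g f surj_g.
have /choice[a aP] : forall j, exists a, g a = f (delta_mx 0 j).
  by move=> j; apply: surj_g.
exists (lincomb a) => x; rewrite /lincomb {2}[x]row_sum_delta !linear_sum.
by apply: eq_bigr => j _; rewrite !linearZ_LR aP.
Qed.

Lemma minimal_mx0_rows b c (B : 'M[R]_(b, c)) :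
  split_local I J -> minimal_mx I J B -> B = 0 -> b = 0%N.
Proof.
move=> splitIJ minB B0; case: b B minB B0 => // b B minB B0.
case: (split_proper splitIJ).
have := minB _ (1%:M : 'M_b.+1); rewrite B0 mulmx0.
by move=> /(_ erefl ord0 ord0); rewrite mxE.
Qed.

(** The instance of the Auslander-Buchsbaum formula used here: a nonzero second
    syzygy is not free. *)
Lemma second_syzygy_not_free c b a (C : 'M[R]_(c, b)) (B : 'M[R]_(b, a)) :
  split_local I J -> minimal_mx I J B -> exact_mx C B ->
  (forall v : 'rV_c, v *m C = 0 -> v = 0) -> C = 0.
Proof.
move=> splitIJ minB exCB injC.
have [C1 [C2 [IC1 JC2 -> C1B C2B]]] := kernel_split splitIJ minB exCB.1.
have noright I' J' (x : 'rV_b) : split_local I' J' -> minimal_mx I' J' B ->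
    entries_in J' x -> x *m B = 0 -> x = 0.
  move=> split' minB' Jx xB; apply: contrapT => /eqP x0.
  have [u [j [uj1 uI]]] := unit_vector_right split' minB' exCB Jx xB x0.
  have [t It] := splitl_neq0 split'; case/eqP.
  have := congr1 (fun v : 'rV_c => v 0 j) (injC _ (uI t It)).
  by rewrite !mxE uj1 mulr1.
rewrite -[0]addr0; congr (_ + _); apply/row_matrixP=> i; rewrite row0.
  apply: (noright J I) (split_localC splitIJ) (minimal_mxC minB) _ _.
    by move=> k l; rewrite mxE.
  by rewrite -row_mul C1B row0.
apply: (noright I J) splitIJ minB _ _.
  by move=> k l; rewrite mxE.
by rewrite -row_mul C2B row0.
Qed.

Section Resolution.
Variables (M : lmodType R) (q : nat -> nat) (D : forall n, 'M[R]_(q n.+1, q n)).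
Variables (g : 'I_(q 0) -> M).
Hypothesis resD : minimal_resolution D g.

Fact mulmxr_aug_exact : exact (row_map (D 0)) (lincomb g).
Proof. exact: minres_aug resD. Qed.

Fact mulmxr_exact n : exact (row_map (D n.+1)) (row_map (D n)).
Proof.
have [DD0 exD] := minres_exact resD n.
move=> y; split=> [/exD[w ->]|[w <-]]; first by exists w.
by rewrite /= -mulmxA DD0 mulmx0.
Qed.

(** The projective resolution given by a minimal free resolution. *)
Definition matrix_resolution : proj_resolution M :=
  ProjResolution (fun n => @free_projective (q n)) (minres_gen resD)
    mulmxr_aug_exact mulmxr_exact.

Lemma entries_in_resolution n :
  split_local I J -> entries_in (ideal_add I J) (D n).
Proof.
move=> splitIJ; case: n => [|n].
  move=> i j; have rowD0 : lincomb g (row i (D 0%N)) = 0.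
    by apply/(minres_aug resD); exists (delta_mx 0 i); rewrite -rowE.
  by have := minres_aug_min resD rowD0 0 j; rewrite mxE.
by apply: (minres_min resD) => //; have [] := minres_exact resD n.
Qed.

Lemma resolution_pd_le1 : split_local I J -> q 2 = 0%N -> pd_le M 1.
Proof.
move=> splitIJ q2; exists matrix_resolution.
suff q0 n : q n.+2 = 0%N.
  case=> [|[|n]] // _ x; apply/rowP=> -[i lti]; exfalso.
  by move: lti; rewrite q0.
elim: n => // n qn.
apply: (minimal_mx0_rows splitIJ (minres_min resD (n := n.+2))).
by apply/matrixP=> i [j ltj]; exfalso; move: ltj; rewrite qn.
Qed.

Lemma resolution_vanish n :
  split_local I J -> q n.+2 = 0%N -> q 2 = 0%N.
Proof.
move=> splitIJ; elim: n => // n IHn qn; apply: IHn.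
apply: (minimal_mx0_rows splitIJ (minres_min resD (n := n.+1))).
apply: (second_syzygy_not_free splitIJ (minres_min resD (n := n))
          (minres_exact resD n)).
move=> v /(minres_exact resD n.+1).2[w ->]; rewrite (_ : w = 0) ?mul0mx //.
by apply/rowP=> -[j ltj]; exfalso; move: ltj; rewrite qn.
Qed.

(** [gN] and [DN] give a free presentation of [N]. *)
Lemma Ext_eq0_mx (N : lmodType R) n r s (gN : 'I_r -> N) (DN : 'M[R]_(s, r)) :
  surjective_map (lincomb gN) ->
  (forall c, lincomb gN c = 0 <-> exists w, w *m DN = c) ->
  Ext_eq0 n.+1 M N ->
  forall (B : 'M_(q n.+1, r)) V, D n.+1 *m B = V *m DN ->
  exists C W, B = D n *m C + W *m DN.
Proof.
move=> surjN augN extN B V DB.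
have [x|h hP] := Ext_eq0_any (Q := matrix_resolution) extN
    (f := lincomb gN \o row_map B).
  rewrite /= -mulmxA DB mulmxA; apply/augN; by exists (x *m V).
have /choice[c cP] : forall j, exists c, lincomb gN c = h (delta_mx 0 j).
  by move=> j; apply: surjN.
pose C := \matrix_j c j.
have hE x : h x = lincomb gN (x *m C).
  rewrite {1}[x]row_sum_delta mulmx_sum_row !linear_sum.
  by apply: eq_bigr => j _; rewrite !linearZ_LR /= rowK cP.
have [W WE] : exists W, B - D n *m C = W *m DN.
  apply: row_factor => i.
  have /augN[w <-] : lincomb gN (row i (B - D n *m C)) = 0.
    rewrite rowE mulmxBr linearB mulmxA /=; have /= -> := hP (delta_mx 0 i).
    by rewrite hE subrr.
  by exists w.
by exists C, W; rewrite -WE addrC subrK.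
Qed.

End Resolution.
End MinimalResolution.

(** * Tensor products with cokernels of matrices *)

Section TensorCoordinates.
Variables (R : comNzRingType) (Z : lmodType R).

Section Coordinate.
Variables (q : nat) (j : 'I_q).

Definition coord_pure (v : 'rV[R]_q) (z : Z) : Z := v 0 j *: z.

Fact coord_pure_bilinear : bilinear_for *:%R *:%R coord_pure.
Proof.
split=> [z a v w|v a y z]; rewrite /coord_pure.
- by rewrite /= !mxE scalerDl scalerA.
- by rewrite /= scalerDr !scalerA mulrC.
Qed.

HB.instance Definition _ :=
  bilinear_isBilinear.Build R 'rV[R]_q Z Z *:%R *:%R coord_pure
    coord_pure_bilinear.

(** The [j]-th coordinate on the tensor product of R^q and [Z], identified
    with Z^q. *)
Definition tensor_coord : {linear tensor 'rV[R]_q Z -> Z} :=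
  tensor_lift coord_pure.

Lemma tensor_coordE v z : tensor_coord (tensor_pure v z) = v 0 j *: z.
Proof. exact: tensor_lift_pure. Qed.

End Coordinate.

(** The element of the tensor product with given coordinates. *)
Definition tensor_of q (x : 'I_q -> Z) : tensor 'rV[R]_q Z :=
  \sum_j tensor_pure (delta_mx 0 j) (x j).

Lemma tensor_coord_of q (x : 'I_q -> Z) j : tensor_coord j (tensor_of x) = x j.
Proof.
rewrite linear_sum (bigD1 j) //= tensor_coordE mxE !eqxx scale1r big1 ?addr0 //.
by move=> i /negPf ij; rewrite tensor_coordE mxE eqxx eq_sym ij scale0r.
Qed.

Lemma tensor_of_coord q (t : tensor 'rV[R]_q Z) :
  t = tensor_of (fun j => tensor_coord j t).
Proof.
elim/tensor_ind: t => [|s t es et|v z].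
- rewrite /tensor_of big1 // => j _; by rewrite linear0 linear0r.
- rewrite {1}es {1}et /tensor_of -big_split; apply: eq_bigr => j _.
  by rewrite linearD linearDr.
- rewrite {1}[v]row_sum_delta linear_sumlz; apply: eq_bigr => j _.
  by rewrite tensor_coordE linearZl_LR linearZr_LR.
Qed.

Lemma tensor_coord_inj q (s t : tensor 'rV[R]_q Z) :
  (forall j, tensor_coord j s = tensor_coord j t) -> s = t.
Proof.
move=> st; rewrite (tensor_of_coord s) (tensor_of_coord t).
by apply: eq_bigr => j _; rewrite st.
Qed.

Lemma tensor_coord_map a b (D : 'M[R]_(a, b)) t j :
  tensor_coord j (tensor_map Z (row_map D) t) =
  \sum_i D i j *: tensor_coord i t.
Proof.
rewrite {1}(tensor_of_coord t) /tensor_of.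
rewrite (linear_sum (tensor_map Z (row_map D))) (linear_sum (tensor_coord j)).
apply: eq_bigr => i _.
by rewrite tensor_mapE tensor_coordE /= -rowE mxE.
Qed.

Lemma tensor_exact_coord a b c (D : 'M[R]_(a, b)) (D' : 'M[R]_(b, c)) :
  exact (tensor_map Z (row_map D)) (tensor_map Z (row_map D')) <->
  forall x : 'I_b -> Z, (forall k, \sum_j D' j k *: x j = 0) <->
    exists y : 'I_a -> Z, forall j, x j = \sum_i D i j *: y i.
Proof.
split=> [exD x|exD t].
  have xE : (forall k, \sum_j D' j k *: x j = 0) <->
      tensor_map Z (row_map D') (tensor_of x) = 0.
    split=> [x0|x0 k].
      apply: tensor_coord_inj => k.
      rewrite tensor_coord_map linear0 -[RHS](x0 k).
      by apply: eq_bigr => j _; rewrite tensor_coord_of.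
    have := congr1 (tensor_coord k) x0; rewrite linear0 tensor_coord_map.
    by apply: etrans; apply: eq_bigr => j _; rewrite tensor_coord_of.
  apply: (iff_trans xE); apply: (iff_trans (exD _)); split=> -[y yP].
    exists (fun i => tensor_coord i y) => j.
    by rewrite -tensor_coord_map yP tensor_coord_of.
  exists (tensor_of y); apply: tensor_coord_inj => j.
  rewrite tensor_coord_map tensor_coord_of yP.
  by apply: eq_bigr => i _; rewrite tensor_coord_of.
have tE : tensor_map Z (row_map D') t = 0 <->
    forall k, \sum_j D' j k *: tensor_coord j t = 0.
  split=> [t0 k|t0]; first by rewrite -tensor_coord_map t0 linear0.
  by apply: tensor_coord_inj => k; rewrite tensor_coord_map linear0.
apply: (iff_trans tE); apply: (iff_trans (exD _)); split=> -[y yP].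
  exists (tensor_of y); apply: tensor_coord_inj => j.
  rewrite tensor_coord_map yP.
  by apply: eq_bigr => i _; rewrite tensor_coord_of.
by exists (fun i => tensor_coord i y) => j; rewrite -yP tensor_coord_map.
Qed.

End TensorCoordinates.

Section MatrixCokernel.
Variables (R : comNzRingType) (b1 b0 : nat) (B : 'M[R]_(b1, b0)).

(** The module presented by the rows of [B]. *)
Definition mx_coker : lmodType R := coker (row_map B).

Lemma mx_coker_fin_gen : fin_gen mx_coker.
Proof.
exists b0, (fun i => coker_pi (row_map B) (delta_mx 0 i)) => x.
have [v <-] := coker_pi_surj x; exists (fun i => v 0 i).
rewrite {1}[v]row_sum_delta linear_sum.
by apply: eq_bigr => i _; rewrite linearZ_LR.
Qed.

(** The classes of the columns of [U], an element of a power of the cokernel. *)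
Definition coker_cols q (U : 'M[R]_(b0, q)) (j : 'I_q) : mx_coker :=
  coker_pi (row_map B) (col j U)^T.

Lemma coker_cols_mul q r (U : 'M[R]_(b0, q)) (D : 'M[R]_(q, r)) k :
  \sum_j D j k *: coker_cols U j = coker_cols (U *m D) k.
Proof.
rewrite /coker_cols; under eq_bigr do rewrite -linearZ_LR.
rewrite -linear_sum; congr coker_pi; apply/rowP=> i.
rewrite summxE !mxE; apply: eq_bigr => j _.
by rewrite !mxE mulrC.
Qed.

Lemma coker_cols_surj q (x : 'I_q -> mx_coker) :
  exists U, forall j, x j = coker_cols U j.
Proof.
have /choice[v vP] : forall j, exists v, coker_pi (row_map B) v = x j.
  by move=> j; apply: coker_pi_surj.
exists (\matrix_(i, j) v j 0 i) => j; rewrite /coker_cols -vP; congr coker_pi.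
by apply/rowP=> i; rewrite !mxE.
Qed.

Lemma coker_colsB q (U V : 'M[R]_(b0, q)) j :
  coker_cols (U - V) j = coker_cols U j - coker_cols V j.
Proof. by rewrite /coker_cols !linearB. Qed.

Lemma coker_cols_eq0 q (U : 'M[R]_(b0, q)) :
  (forall j, coker_cols U j = 0) <-> exists V, U = B^T *m V.
Proof.
split=> [U0|[V ->] j].
  have [j|W WE] := @row_factor R _ _ _ U^T B.
    by have /coker_pi_eq0[w wE] := U0 j; exists w; rewrite -tr_col.
  by exists W^T; rewrite -trmx_mul -WE trmxK.
apply/coker_pi_eq0; exists (col j V)^T.
by rewrite /= colE -mulmxA -colE trmx_mul trmxK.
Qed.

Section Tor.
Variables (I J : set R) (N : lmodType R) (q : nat -> nat).
Variables (D : forall n, 'M[R]_(q n.+1, q n)) (g : 'I_(q 0) -> N).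
Hypothesis resD : minimal_resolution I J D g.

Lemma tor_trivial_of_Tor n : Tor_eq0 n.+1 N mx_coker -> tor_trivial B (D n).
Proof.
move=> /(Tor_eq0_any (Q := matrix_resolution resD)) /tensor_exact_coord torN.
move=> V U VU.
have [|y yP] := (torN (coker_cols U)).1.
  move=> k; rewrite coker_cols_mul -VU.
  by move: k; apply/coker_cols_eq0; exists V.
have [W WE] := coker_cols_surj y.
have /coker_cols_eq0[V' V'E] : forall j, coker_cols (U - W *m D n.+1) j = 0.
  move=> j; rewrite coker_colsB yP -coker_cols_mul; apply/eqP; rewrite subr_eq0.
  by apply/eqP/eq_bigr => i _; rewrite WE.
exists V'; rewrite -V'E mulmxBl -mulmxA.
by have [-> _] := minres_exact resD n; rewrite mulmx0 subr0.
Qed.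

Lemma Tor_eq0_of_mx n :
  (forall (U : 'M_(b0, q n.+1)) V, U *m D n = B^T *m V ->
     exists W V', U = W *m D n.+1 + B^T *m V') -> Tor_eq0 n.+1 N mx_coker.
Proof.
move=> h; exists (matrix_resolution resD); apply/tensor_exact_coord => x.
have [U UE] := coker_cols_surj x.
have xE k : \sum_j D n j k *: x j = coker_cols (U *m D n) k.
  by rewrite -coker_cols_mul; apply: eq_bigr => j _; rewrite UE.
split=> [x0|[y yP] k].
  have /coker_cols_eq0[V VE] : forall k, coker_cols (U *m D n) k = 0.
    by move=> k; rewrite -xE.
  have [W [V' UE']] := h _ _ VE; exists (coker_cols W) => j.
  rewrite coker_cols_mul UE; apply/eqP; rewrite -subr_eq0 -coker_colsB.
  apply/eqP.
  by move: j; apply/coker_cols_eq0; exists V'; rewrite UE' addrC addKr.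
have [W WE] := coker_cols_surj y.
have -> : \sum_j D n j k *: x j = coker_cols (W *m D n.+1 *m D n) k.
  rewrite -coker_cols_mul; apply: eq_bigr => j _; rewrite yP -coker_cols_mul.
  by congr (_ *: _); apply: eq_bigr => i _; rewrite WE.
move: k; apply/coker_cols_eq0; exists 0; rewrite mulmx0 -mulmxA.
by have [-> _] := minres_exact resD n; rewrite mulmx0.
Qed.

End Tor.
End MatrixCokernel.

(** * Vanishing of Ext against a Tor-rigid module *)

Theorem corollary3p17 (R : comNzRingType) (M N : lmodType R) :
  local_ring R -> fiber_product_ring R -> cohen_macaulay R ->
  fin_gen M -> fin_gen N -> nonzero_module M -> nonzero_module N ->
  tor_rigid N ->
  (exists i : nat, (1 < i)%N /\ Ext_eq0 i M N) ->
  pd_le M 1 \/ pd_le N 1.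
Proof.
move=> locR fibR _ fgM fgN _ [x0 x0n0] rigN [[|[|i]] [// _ extMN]].
have [I [J splitIJ]] := fiber_product_split locR fibR.
have [noeR _] := locR; have idm := split_max_ideal splitIJ.
have [p [A [gM resM]]] := minimal_resolution_exists splitIJ noeR fgM.
have [q [D [gN resN]]] := minimal_resolution_exists splitIJ noeR fgN.
have exA := minres_exact resM; have exD := minres_exact resN.
have minD n : minimal_mx I J (D n) := minres_min resN (n := n).
have ext := Ext_eq0_mx resM (minres_gen resN) (minres_aug resN) extMN.
pose B := (A i.+2)^T.
have tor1 : Tor_eq0 1 N (mx_coker B).
  apply: (Tor_eq0_of_mx resN) => U V; rewrite trmxK => UV.
  have [C [W VE]] := ext V U (esym UV).
  have [|S SE] := (exD 0%N).2 _ (U - A i.+2 *m W).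
    rewrite mulmxBl UV {1}VE mulmxDr !mulmxA; have [-> _] := exA i.+1.
    by rewrite mul0mx add0r subrr.
  by exists S, W; rewrite -SE subrK.
have torN n : Tor_eq0 n.+1 N (mx_coker B).
  elim: n => // n; apply: rigN => //; exact: mx_coker_fin_gen.
have tor0 n : tor_trivial B (D n) := tor_trivial_of_Tor resN (torN n).
(* for a column [b] killed by A_i and a basis row [e], the vanishing of Ext
   writes [b *m e] as A_(i-1) C + W D_0, with entries in the maximal ideal *)
have minB : minimal_mx I J B.
  apply: minimal_rowsP => v vB0.
  have [j0 _] : exists j0 : 'I_(q 0), true.
    case: (posnP (q 0)) => [q0|q0_gt0]; last by exists (Ordinal q0_gt0).
    have [c cE] := minres_gen resN x0; case/eqP: x0n0; rewrite -cE.
    by rewrite /lincomb big1 // => -[j ltj]; exfalso; move: ltj; rewrite q0.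
  have [|C [W vE]] := ext (v^T *m delta_mx 0 j0) 0.
    by rewrite mulmxA -[A _]trmxK -trmx_mul vB0 trmx0 !mul0mx.
  move=> k l; rewrite ord1 {k}.
  have <- : (v^T *m (delta_mx 0 j0 : 'rV_(q 0))) l j0 = v 0 l.
    by rewrite mxE big_ord1 !mxE !eqxx mulr1.
  rewrite vE; apply: entries_inD => //.
    by apply: entries_in_mulr => //; apply: (entries_in_resolution resM).
  by apply: entries_in_mull => //; apply: (entries_in_resolution resN).
have [b2 [B1 [exB1 minB1]]] := syzygy_exists splitIJ B noeR.
have [b3 [B2 [exB2 _]]] := syzygy_exists splitIJ B1 noeR.
have tor1' n := tor_trivial_shift exB1 (exD n) (tor0 n.+1).
have tor2 := tor_trivial_shift exB2 (exD 2) (tor1' 3).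
have [B10|D10] := tor_trivial_syzygy splitIJ minB minB1 (minD 0%N) (minD 1%N)
  exB1 exB2 (exD 0%N) (exD 1%N) (tor1' 2) tor2; [left | right].
  apply: (resolution_pd_le1 resM splitIJ).
  apply: (resolution_vanish resM (n := i)) => //.
  apply: (minimal_mx0_rows splitIJ (minres_min resM (n := i.+1))).
  have [|W WE] := exB1.2 _ (A i.+1)^T.
    by rewrite -trmx_mul; have [-> _] := exA i.+1; rewrite trmx0.
  by apply: trmx_inj; rewrite WE B10 mulmx0 trmx0.
apply: (resolution_pd_le1 resN splitIJ).
exact: (minimal_mx0_rows splitIJ (minD 1%N) D10).
Qed.
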